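(* The function $\lambda:(0,\infty)\to\mathbb{R}$ defined by $$\lambda(x)=\frac{\Gamma(x+1)}{\sqrt{2\pi x}\,(x/e)^{x}}-1,\qquad x>0,$$ is strictly decreasing on $(0,\infty)$.
   Context: $\Gamma$ denotes the Euler gamma function. *)

(* Defs.v *)
From HB Require Import structures.
From mathcomp Require Import all_boot all_order all_algebra.
From mathcomp Require Import all_classical all_reals all_analysis.

Set Implicit Arguments.
Unset Strict Implicit.
Unset Printing Implicit Defensive.

Import Order.TTheory GRing.Theory Num.Theory.
Import numFieldNormedType.Exports.

Local Open Scope classical_set_scope.
Local Open Scope ring_scope.

(* Euler's integral of the second kind, for the Lebesgue measure. It is the
   gamma function for [0 < x] only: elsewhere the integral diverges and
   [Rintegral] returns a default value. *)
Definition Gamma (R : realType) (x : R) : R :=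
  Rintegral (@lebesgue_measure R) `]0, +oo[
    (fun t : R => t `^ (x - 1) * expR (- t)).

(* Total on [R], but meaningful for [0 < x] only. *)
Definition lambda (R : realType) (x : R) : R :=
  Gamma (x + 1) / (Num.sqrt (2 * pi * x) * (x / expR 1) `^ x) - 1.

(* Main.v *)
Require Import Defs.
From mathcomp Require Import all_boot all_order all_algebra.
From mathcomp Require Import all_classical all_reals all_analysis.
From mathcomp Require Import measurable_realfun ring lra.
Import Order.TTheory GRing.Theory Num.Theory.
Import numFieldNormedType.Exports.
Local Open Scope classical_set_scope.
Local Open Scope ring_scope.

(** Write [mu x = ln (Gamma (x + 1)) - (x + 1/2) ln x + x].  Then
    [lambda x = exp (mu x) / sqrt (2 pi) - 1], so the claim is that [mu] strictly
    decreases.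

    The functional equation of [Gamma] turns the step [mu x - mu (x + 1)] into the
    elementary function [g x = (x + 1/2) ln ((x + 1) / x) - 1], which strictly
    decreases because its derivative at [x] is [ln s - (s - 1/s) / 2 < 0] with
    [s = (x + 1) / x > 1] ([ln_lt_half_subV], [binet_increment_decr]).  Hence,
    for [x < y], the gap [mu x - mu y] strictly decreases under the shift
    [(x, y) |-> (x + 1, y + 1)].

    It remains to see that the shifted gaps do not become negative in the limit.
    Log-convexity of [Gamma] gives [Gamma (y + 1) <= (y + 1)^(y - x) Gamma (x + 1)]
    ([Gamma_le_powR]), and elementary bounds on [ln] convert it into
    [mu x - mu y >= - K / y] where [K] depends on [y - x] alone ([binet_sub_ge]).
    After [n] shifts the lower bound is [- K / (y + n)], which tends to [0].  The
    value of [lim mu], that is Stirling's constant, never enters.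

    On the side of the integral, three facts about [Gamma] at arguments larger
    than [1] are used: the functional equation, positivity and the
    above inequality.  Convergence comes from a domination of the integrand by
    a multiple of [exp (- t / 2)]. *)

(** * Euler's integrand *)

Definition gamma_kernel {R : realType} (a t : R) : R := t `^ a * expR (- t).

Lemma gamma_kernel_ge0 {R : realType} (a t : R) : 0 <= gamma_kernel a t.
Proof. by rewrite mulr_ge0 ?powR_ge0 ?expR_ge0. Qed.

(** With [u = t / (2 a)], the inequality [u <= exp u] raised to the power [a] reads
    [t^a <= (2 a)^a exp (t / 2)]; half of the decay of [exp (- t)] remains. *)
Lemma gamma_kernel_le {R : realType} (a t : R) : 0 < a -> 0 <= t ->
  gamma_kernel a t <= (2 * a) `^ a * expR (- 2^-1 * t).
Proof.
move=> a0 t0.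
have h : t `^ a <= (2 * a) `^ a * expR (2^-1 * t).
  have -> : 2^-1 * t = t / (2 * a) * a by field; rewrite gt_eqF.
  rewrite expRM -powRM ?expR_ge0//; last by lra.
  apply: ge0_ler_powR; rewrite ?nnegrE ?mulr_ge0 ?expR_ge0 ?(ltW a0)//.
  rewrite -ler_pdivrMl; last by lra.
  by rewrite mulrC; apply: le_trans (expR_ge1Dx _); rewrite lerDr.
rewrite /gamma_kernel.
have -> : - 2^-1 * t = 2^-1 * t + - t by field.
by rewrite expRD mulrA ler_pM2r ?expR_gt0.
Qed.

Lemma continuous_expRM {R : realType} (k : R) :
  continuous (fun z : R => expR (k * z)).
Proof.
move=> z; apply: continuous_comp; last exact: continuous_expR.
exact: mulrl_continuous.
Qed.

Lemma cvg_expRM_pinfty {R : realType} (k : R) : k < 0 ->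
  expR (k * t) @[t --> +oo] --> 0.
Proof.
move=> k0.
rewrite (_ : (fun x => expR (k * x)) =
               (fun z => expR (- z)) \o (fun z => (- k) * z)); last first.
  by apply/funext => x /=; rewrite mulNr opprK.
apply: (@cvg_comp _ _ _ _ _ _ (pinfty_nbhs R)); last exact: cvgr_expR.
by apply: gt0_cvgMry; rewrite ?oppr_gt0.
Qed.

Lemma gamma_kernel_cvg_pinfty {R : realType} (a : R) : 0 < a ->
  gamma_kernel a t @[t --> +oo] --> 0.
Proof.
move=> a0.
have hk : (2 * a) `^ a * expR (- 2^-1 * t) @[t --> +oo] --> 0.
  rewrite -[X in _ --> X](mulr0 ((2 * a) `^ a)); apply: cvgM.
    exact: cvg_cst.
  by apply: cvg_expRM_pinfty; lra.
apply: (squeeze_cvgr _ (cvg_cst 0) hk).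
near=> t; rewrite gamma_kernel_ge0 /=; apply: gamma_kernel_le => //.
Unshelve. end_near. Qed.

Lemma is_derive_gamma_kernel {R : realType} (a t : R) : 0 < t ->
  is_derive t 1 (gamma_kernel a)
    (a * gamma_kernel (a - 1) t - gamma_kernel a t).
Proof.
move=> t0; rewrite /gamma_kernel.
have dp := is_derive1_powR a t0.
apply: is_derive_eq; rewrite /GRing.scale /=; ring.
Qed.

Lemma gamma_kernel_continuous {R : realType} (a t : R) : 0 < t ->
  {for t, continuous (gamma_kernel a)}.
Proof.
move=> t0; apply/differentiable_continuous/derivable1_diffP.
by have [] := is_derive_gamma_kernel a t t0.
Qed.

Lemma gamma_kernel_cvg_at_right0 {R : realType} (a : R) : 0 < a ->
  gamma_kernel a t @[t --> 0^'+] --> 0.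
Proof.
move=> a0; rewrite -[X in _ --> X](mul0r 1).
apply: cvgM; first exact: powR_cvg0.
rewrite -[X in _ --> X]expR0 -[in X in _ --> X]oppr0.
apply: cvg_at_right_filter; apply: continuous_comp; last exact: continuous_expR.
exact: opp_continuous.
Qed.

Lemma is_derive_expRM {R : realType} (k t : R) :
  is_derive t 1 (fun s : R => expR (k * s)) (k * expR (k * t)).
Proof.
by apply: is_derive_eq; rewrite /GRing.scale /=; ring.
Qed.

Lemma integral_expRM_half (R : realType) :
  (\int[@lebesgue_measure R]_(t in `[0%R, +oo[)
     (expR (- 2^-1 * t))%:E = 2%:E)%E.
Proof.
rewrite (@ge0_continuous_FTC2y _ _ (fun t => - 2 * expR (- 2^-1 * t)) _ 0).
- by rewrite mulr0 expR0 mulr1 -EFinB sub0r opprK.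
- by move=> t _; exact: expR_ge0.
- by apply: continuous_subspaceT => t; exact: continuous_expRM.
- rewrite -[X in _ --> X](mulr0 (-2 : R)); apply: cvgM; first exact: cvg_cst.
  by apply: cvg_expRM_pinfty; rewrite oppr_lt0 invr_gt0.
- move=> t _; have [] := is_derive_expRM (- 2^-1) t => + _.
  by move=> h; apply: derivableM; [exact: derivable_cst | exact: h].
- apply: cvg_at_right_filter; apply: cvgM; first exact: cvg_cst.
  exact: continuous_expRM.
- move=> t _; rewrite derive1E.
  have h := is_derive_expRM (- 2^-1) t.
  by rewrite derive_val /GRing.scale /=; field.
Qed.

(** Stated for the sigma-algebra that carries [lebesgue_measure], so that it can
    be passed as such to the lemmas on integrals. *)
Lemma measurable_ray (R : realType) :
  @measurable _ (g_sigma_algebraType R.-ocitv.-measurable)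
    [set` `]0%R, +oo[%R].
Proof. exact: measurable_itv. Qed.

Lemma integrable_expRM_half (R : realType) :
  (@lebesgue_measure R).-integrable `]0, +oo[
    (EFin \o (fun t : R => expR (- 2^-1 * t))).
Proof.
have mE (D : set R) : measurable_fun D (fun t : R => expR (- 2^-1 * t)).
  apply: measurable_funTS; apply: continuous_measurable_fun.
  exact: continuous_expRM.
apply/integrableP; split; first by apply/measurable_EFinP; exact: mE.
under eq_integral do rewrite /= ger0_norm ?expR_ge0//.
rewrite integral_itv_obnd_cbnd ?integral_expRM_half ?ltry//.
by apply/measurable_EFinP; exact: mE.
Qed.

Lemma integrable_gamma_kernel {R : realType} (a : R) : 0 < a ->
  (@lebesgue_measure R).-integrable `]0, +oo[ (EFin \o gamma_kernel a).
Proof.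
move=> a0.
have mD := measurable_ray R.
have := integrableZl mD ((2 * a) `^ a) (integrable_expRM_half R).
apply: le_integrable => //.
- apply/measurable_EFinP; apply: open_continuous_measurable_fun => //.
  by move=> t; rewrite inE/= in_itv/= andbT; exact: gamma_kernel_continuous.
- move=> t /=; rewrite in_itv/= andbT => t0.
  rewrite lee_fin !ger0_norm ?gamma_kernel_ge0 ?mulr_ge0 ?powR_ge0 ?expR_ge0//.
  by apply: gamma_kernel_le => //; exact: ltW.
Qed.

(** * The gamma function *)

Lemma GammaE {R : realType} (a : R) :
  Gamma (a + 1) = \int[@lebesgue_measure R]_(t in `]0, +oo[) gamma_kernel a t.
Proof. by rewrite /Gamma addrK. Qed.

(** The derivative of [t^(a+1) exp (- t)] is [((a + 1) t^a - t^(a+1)) exp (- t)],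
    which changes sign, so that the fundamental theorem of calculus on a half-line
    for nonnegative integrands does not apply.  Subtracting [2 C exp (- t / 2)]
    from the primitive adds [C exp (- t / 2)] to the derivative, and for the
    constant [C] of [gamma_kernel_le] the sum is nonnegative; the added term
    has integral [2 C] and cancels in the end. *)
Lemma GammaS {R : realType} (a : R) : 0 < a ->
  Gamma (a + 1 + 1) = (a + 1) * Gamma (a + 1).
Proof.
move=> a0; rewrite 2!GammaE.
have a10 : 0 < a + 1 by lra.
set C : R := (2 * (a + 1)) `^ (a + 1).
pose F t := gamma_kernel (a + 1) t + - 2 * C * expR (- 2^-1 * t).
pose f t := (a + 1) * gamma_kernel a t - gamma_kernel (a + 1) t +
  C * expR (- 2^-1 * t).
have ig := integrable_gamma_kernel a a0.
have ig1 := integrable_gamma_kernel (a + 1) a10.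
have ie := integrable_expRM_half R.
have mD := measurable_ray R.
have idg : (@lebesgue_measure R).-integrable `]0, +oo[
    (EFin \o (fun t => (a + 1) * gamma_kernel a t - gamma_kernel (a + 1) t)).
  by have := integrableB mD (integrableZl mD (a + 1) ig) ig1; exact.
have iCe : (@lebesgue_measure R).-integrable `]0, +oo[
    (EFin \o (fun t => C * expR (- 2^-1 * t))).
  exact: (integrableZl mD C ie).
have fE : \int[@lebesgue_measure R]_(t in `]0, +oo[) f t =
  (a + 1) * \int[@lebesgue_measure R]_(t in `]0, +oo[) gamma_kernel a t -
  \int[@lebesgue_measure R]_(t in `]0, +oo[) gamma_kernel (a + 1) t
  + C * \int[@lebesgue_measure R]_(t in `]0, +oo[) expR (- 2^-1 * t).
  rewrite RintegralD// RintegralB//; last first.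
    exact: (integrableZl mD (a + 1) ig).
  by rewrite !RintegralZl.
move: fE; rewrite Rintegral_itv_obnd_cbnd; last exact: (integrableD mD idg iCe).
rewrite [X in C * X]Rintegral_itv_obnd_cbnd// [X in C * X]/Rintegral.
rewrite integral_expRM_half/=.
suff -> : \int[@lebesgue_measure R]_(t in `[0, +oo[) f t = 2 * C by lra.
have derF (t : R) : 0 < t -> is_derive t 1 F (f t).
  move=> t0; rewrite /F /f.
  have h1 := is_derive_gamma_kernel (a + 1) t t0.
  have h2 := is_derive_expRM (- 2^-1) t.
  by apply: is_derive_eq; rewrite /GRing.scale /= addrK; field.
have cE : forall u : R,
    {for u, continuous (fun s : R => - 2 * C * expR (- 2^-1 * s))}.
  by move=> u; apply: cvgM; [exact: cvg_cst | exact: continuous_expRM].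
have k0 b : 0 < b -> gamma_kernel b 0 = 0.
  by move=> b0; rewrite /gamma_kernel powR0 ?mul0r// gt_eqF.
suff -> : \int[@lebesgue_measure R]_(t in `[0, +oo[) f t = 0 - F 0.
  by rewrite /F k0// mulr0 expR0; ring.
apply: Rintegral_ge0_continuous_FTC2y.
- move=> t t0; rewrite /f.
  have := gamma_kernel_le (a + 1) t a10 t0; rewrite -/C => h1.
  have h2 : 0 <= (a + 1) * gamma_kernel a t.
    by rewrite mulr_ge0 ?gamma_kernel_ge0 ?ltW.
  lra.
- apply/continuous_within_itvcyP; split.
    move=> t; rewrite in_itv/= andbT => t0.
    apply: cvgD; first apply: cvgB.
    + by apply: cvgM; [exact: cvg_cst|exact: gamma_kernel_continuous].
    + exact: gamma_kernel_continuous.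
    + by apply: cvgM; [exact: cvg_cst|exact: continuous_expRM].
  rewrite /f !k0//.
  apply: cvgD; first apply: cvgB.
  + by apply: cvgM; [exact: cvg_cst|exact: gamma_kernel_cvg_at_right0].
  + exact: gamma_kernel_cvg_at_right0.
  + apply: cvg_at_right_filter.
    by apply: cvgM; [exact: cvg_cst|exact: continuous_expRM].
- rewrite -[X in _ --> X](addr0 0); apply: cvgD.
    exact: gamma_kernel_cvg_pinfty.
  rewrite -[X in _ --> X](mulr0 (- 2 * C)).
  apply: cvgM; first exact: cvg_cst.
  by apply: cvg_expRM_pinfty; rewrite oppr_lt0 invr_gt0.
- by move=> t t0; have [] := derF t t0.
- rewrite /F k0//; apply: cvgD; first exact: gamma_kernel_cvg_at_right0.
  by apply: cvg_at_right_filter; exact: cE.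
- move=> t; rewrite in_itv/= andbT => t0; rewrite derive1E.
  by have [] := derF t t0.
Qed.

(** On [[1, 2]], a set of measure [1], the integrand is at least [exp (- 2)]. *)
Lemma Gamma_gt0 {R : realType} (a : R) : 0 < a -> 0 < Gamma (a + 1).
Proof.
move=> a0; rewrite GammaE.
have ig := integrable_gamma_kernel a a0.
have mD := measurable_ray R.
have mI : measurable (`[1, 2] : set R) by [].
have sID : `[1, 2] `<=` (`]0, +oo[ : set R).
  by move=> t /=; rewrite !in_itv/= andbT => /andP[t1 _]; lra.
rewrite /Rintegral fine_gt0//; apply/andP; split; last first.
  have /integrable_fin_num := ig.
  move=> /(_ mD); rewrite ge0_fin_numE//; apply: integral_ge0 => t _.
  by rewrite lee_fin gamma_kernel_ge0.
have mg := measurable_int _ ig.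
apply: (@lt_le_trans _ _
    (\int[@lebesgue_measure R]_(t in `[1%R, 2%R]) (expR (- 2))%:E)%E).
  rewrite integral_cst//= lebesgue_measure_itv/= lte_fin ltr1n/=.
  by rewrite -EFinB -EFinM lte_fin mulr_gt0 ?expR_gt0//; lra.
apply: (@le_trans _ _
    (\int[@lebesgue_measure R]_(t in `[1%R, 2%R]) (gamma_kernel a t)%:E)%E).
  apply: ge0_le_integral => //=.
  - exact: (measurable_funS mD sID mg).
  - move=> t; rewrite in_itv/= => /andP[t1 t2]; rewrite lee_fin /gamma_kernel.
    rewrite -[leLHS]mul1r ler_pM ?expR_ge0 ?ler_expR// ?lerN2//.
    by rewrite -[leLHS](powRr0 t) ler_powR// ltW.
apply: ge0_subset_integral => //.
by move=> t _; rewrite lee_fin gamma_kernel_ge0.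
Qed.

(** A consequence of log-convexity, obtained here without Hoelder's inequality.
    Put [c = y + 1] and [d = y - x].  From [exp z >= 1 + z] and [ln u <= u - 1],
    [(c / t)^d >= 1 + d ln (c / t) >= 1 + d - d t / c].  Multiplying by
    [t^y exp (- t)] and integrating,
    [c^d Gamma (x + 1) >= (1 + d) Gamma (y + 1) - (d / c) Gamma (y + 2)], and the
    right-hand side is [Gamma (y + 1)] by the functional equation: [c] is the
    mean of [t] for the weight [t^y exp (- t)]. *)
Lemma Gamma_le_powR {R : realType} (x y : R) : 0 < x -> x < y ->
  Gamma (y + 1) <= (y + 1) `^ (y - x) * Gamma (x + 1).
Proof.
move=> x0 xy; set c := y + 1; set d := y - x.
have d0 : 0 < d by rewrite /d; lra.
have c0 : 0 < c by rewrite /c; lra.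
have y0 : 0 < y by lra.
have y10 : 0 < y + 1 by lra.
have mD := measurable_ray R.
have ix := integrable_gamma_kernel x x0.
have iy := integrable_gamma_kernel y y0.
have iy1 := integrable_gamma_kernel (y + 1) y10.
have icx := integrableZl mD (c `^ d) ix.
have idy := integrableZl mD (d / c) iy1.
have iddy := integrableZl mD (1 + d) iy.
have pw (t : R) : 0 < t -> (1 + d) * gamma_kernel y t <=
    c `^ d * gamma_kernel x t + d / c * gamma_kernel (y + 1) t.
  move=> t0; have tn0 : t != 0 by rewrite gt_eqF.
  have -> : gamma_kernel x t = t `^ (- d) * gamma_kernel y t.
    rewrite /gamma_kernel mulrA -powRD ?tn0 ?implybT//.
    by congr (_ * _); congr powR; rewrite /d; ring.
  have -> : gamma_kernel (y + 1) t = t * gamma_kernel y t.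
    by rewrite /gamma_kernel powRD ?tn0 ?implybT// powRr1 ?ltW//; ring.
  have := gamma_kernel_ge0 y t; move: (gamma_kernel y t) => g g0.
  rewrite !mulrA -mulrDl ler_wpM2r//.
  have -> : c `^ d * t `^ (- d) = expR (- (d * ln (t / c))).
    rewrite /powR !gt_eqF// -expRD ln_div ?posrE//; congr expR; ring.
  apply: le_trans (_ : 1 + - (d * ln (t / c)) + d / c * t <= _); last first.
    by rewrite lerD2r expR_ge1Dx.
  have tc0 : 0 < t / c by rewrite divr_gt0.
  have : ln (t / c) <= t / c - 1.
    rewrite -[in ln _](subrKC 1 (t / c)) le_ln1Dx//; lra.
  rewrite -(ler_pM2l d0).
  have -> : d / c * t = d * (t / c) by ring.
  lra.
have := @le_Rintegral _ _ _ (@lebesgue_measure R) _ _ _ mD iddy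
  (integrableD mD icx idy).
move=> /(_ _)/wrap[|].
  by move=> t; rewrite /= in_itv/= andbT; exact: pw.
rewrite RintegralD// !RintegralZl// -!GammaE GammaS//.
have -> : d / c * ((y + 1) * Gamma (y + 1)) = d * Gamma (y + 1).
  by rewrite -/c; field; rewrite gt_eqF.
lra.
Qed.

(** * The increments of Binet's function *)

Lemma is_derive_gt0_lt {R : realType} (f df : R -> R) (a b : R) : a < b ->
  (forall x, a <= x <= b -> is_derive x 1 f (df x)) ->
  (forall x, a < x < b -> 0 < df x) -> f a < f b.
Proof.
move=> ab dfE df0.
have [|c|c cab fE] := @MVT R f df a b ab.
- by move=> x; rewrite in_itv/= => /andP[ax xb]; apply: dfE; rewrite !ltW.
- move=> /=; apply: derivable_within_continuous => x; rewrite in_itv/= => xab.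
  by have [] := dfE x xab.
- move: cab; rewrite in_itv/= => /df0 h.
  by rewrite -subr_gt0 fE mulr_gt0// subr_gt0.
Qed.

(** Equality holds at [1], and the difference of the two sides has derivative
    [(1 - 1/s)^2 / 2]. *)
Lemma ln_lt_half_subV {R : realType} (s : R) : 1 < s -> ln s < (s - s^-1) / 2.
Proof.
move=> s1.
pose f (x : R) := (x - x^-1) / 2 - ln x.
have f1 : f 1 = 0 by rewrite /f ln1 invr1; lra.
suff : f 1 < f s by rewrite f1 /f; lra.
apply: (@is_derive_gt0_lt _ f (fun x => (1 - x^-1) ^+ 2 / 2)) => //
  x /andP[x1 xs].
  have x0 : x != 0 by rewrite gt_eqF//; lra.
  have dl := is_derive1_ln (lt_le_trans ltr01 x1).
  have dV : is_derive x 1 (fun t : R => t^-1) (- x ^- 2).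
    have := is_deriveV x0 (is_derive_id x (1 : R)).
    by rewrite /GRing.scale /= mulr1.
  by rewrite /f; apply: is_derive_eq; rewrite /GRing.scale /=; field.
have xV : x^-1 < 1 by rewrite invf_lt1 ?(lt_trans ltr01 x1).
by rewrite divr_gt0// exprn_gt0// subr_gt0.
Qed.

Definition binet_increment {R : realType} (x : R) : R :=
  (x + 2^-1) * (ln (x + 1) - ln x) - 1.

Lemma binet_increment_decr {R : realType} (x y : R) : 0 < x -> x < y ->
  binet_increment y < binet_increment x.
Proof.
move=> x0 xy.
rewrite -ltrN2.
apply: (@is_derive_gt0_lt _ (fun t => - binet_increment t)
   (fun t => (t + 2^-1) / (t * (t + 1)) - (ln (t + 1) - ln t))) =>
  [//|t /andP[xt ty]|t /andP[xt ty]].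
  have t0 : 0 < t by lra.
  have t1 : 0 < t + 1 by lra.
  have dl := is_derive1_ln t0.
  have dl1 := is_derive1_ln t1.
  have dl2 : is_derive t 1 (fun u : R => ln (u + 1)) (t + 1)^-1.
    by apply: is_derive_eq; rewrite /GRing.scale /=; ring.
  rewrite /binet_increment; apply: is_derive_eq; rewrite /GRing.scale /=.
  by field; rewrite !gt_eqF.
have t0 : 0 < t by lra.
(* For s = (t + 1) / t, the bound (s - 1/s) / 2 is the rational part of the
   derivative. *)
have := @ln_lt_half_subV _ ((t + 1) / t).
rewrite ltr_pdivlMr// mul1r ltrDl ltr01 => /(_ isT).
rewrite ln_div ?posrE//; last by lra.
have -> : ((t + 1) / t - ((t + 1) / t)^-1) / 2 = (t + 2^-1) / (t * (t + 1)).
  by field; rewrite !gt_eqF//; lra.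
lra.
Qed.

(** * Monotonicity of Binet's function *)

(** Binet's function, the logarithm of the ratio of [Gamma (x + 1)] to its Stirling
    approximation, up to the additive constant [ln (2 pi) / 2]. *)
Definition binet {R : realType} (x : R) : R :=
  ln (Gamma (x + 1)) - (x + 2^-1) * ln x + x.

Lemma binet_sub_succ {R : realType} (x : R) : 0 < x ->
  binet x - binet (x + 1) = binet_increment x.
Proof.
move=> x0; rewrite /binet /binet_increment GammaS//.
rewrite lnM ?posrE ?Gamma_gt0//; last by lra.
ring.
Qed.

(** Take logarithms in [Gamma_le_powR] and use [ln y - ln x >= (y - x) / y] and
    [ln (y + 1) - ln y <= 1 / y].  The terms that do not vanish as [y] grows with
    [y - x] fixed cancel exactly. *)
Lemma binet_sub_ge {R : realType} (x y : R) : 0 < x -> x < y ->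
  - ((y - x) * (y - x + 2^-1) / y) <= binet x - binet y.
Proof.
move=> x0 xy; have y0 : 0 < y by lra.
have h2 : (y - x) / y <= ln y - ln x.
  have xy0 : 0 < x / y by rewrite divr_gt0.
  have := @le_ln1Dx _ (x / y - 1); rewrite subrKC => /(_ _)/wrap[|].
    lra.
  rewrite ln_div ?posrE//.
  have -> : (y - x) / y = 1 - x / y by field; rewrite gt_eqF.
  lra.
have h3 : ln (y + 1) - ln y <= y^-1.
  have yV : 0 < y^-1 by rewrite invr_gt0.
  rewrite -ln_div ?posrE//; last by lra.
  have -> : (y + 1) / y = 1 + y^-1 by field; rewrite gt_eqF.
  by rewrite le_ln1Dx//; lra.
have h4 : (x + 2^-1) * ((y - x) / y) <= (x + 2^-1) * (ln y - ln x).
  by rewrite ler_pM2l//; lra.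
have h5 : (y - x) * (ln (y + 1) - ln y) <= (y - x) * y^-1.
  by rewrite ler_pM2l//; lra.
have h1 : ln (Gamma (y + 1)) <= (y - x) * ln (y + 1) + ln (Gamma (x + 1)).
  have y1 : 0 < (y + 1) `^ (y - x) by rewrite powR_gt0// ltr_wpDr.
  have Gx := Gamma_gt0 _ x0; have Gy := Gamma_gt0 _ y0.
  rewrite -ln_powR -lnM ?posrE ?Gx ?y1// ler_ln ?posrE ?Gy ?mulr_gt0 ?Gx ?y1//.
  exact: Gamma_le_powR.
have -> : - ((y - x) * (y - x + 2^-1) / y) =
    (x + 2^-1) * ((y - x) / y) - (y - x) * y^-1 - (y - x).
  by field; rewrite gt_eqF.
move: h1; rewrite /binet.
move: (ln (Gamma (x + 1))) (ln (Gamma (y + 1))) => Lx Ly h1; lra.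
Qed.

(** The gap [binet x - binet y] exceeds the gap at [(x + 1, y + 1)], so that it is
    enough that the latter be nonnegative.  It bounds from above all the further
    shifted gaps, which are at least [- K / (y + 1 + n)]. *)
Lemma binet_decr {R : realType} (x y : R) : 0 < x -> x < y ->
  binet y < binet x.
Proof.
move=> x0 xy.
have step (u v : R) : 0 < u -> u < v ->
    binet (u + 1) - binet (v + 1) < binet u - binet v.
  move=> u0 uv; have v0 : 0 < v by lra.
  have := binet_increment_decr _ _ u0 uv.
  rewrite -!binet_sub_succ//; lra.
have iter (n : nat) (u v : R) : 0 < u -> u < v ->
    binet (u + n%:R) - binet (v + n%:R) <= binet u - binet v.
  move=> u0 uv; elim: n => [|n IHn]; first by rewrite !addr0.
  rewrite -natr1 !addrA (le_trans _ IHn)// ltW// step ?ltrD2r//.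
  by rewrite ltr_wpDr.
rewrite -subr_gt0; apply: le_lt_trans (step _ _ x0 xy).
have x1 : 0 < x + 1 by lra.
have xy1 : x + 1 < y + 1 by lra.
rewrite leNgt; apply/negP => neg.
set K := (y - x) * (y - x + 2^-1).
have K0 : 0 < K by rewrite mulr_gt0; lra.
set e := - (binet (x + 1) - binet (y + 1)).
have e0 : 0 < e by rewrite /e oppr_gt0.
(* A gap - e < 0 is refuted by any n > K / e. *)
have Ke0 : 0 <= K / e by rewrite divr_ge0 ?ltW.
have nP := archi_boundP Ke0; set n := Num.bound _ in nP.
have := iter n _ _ x1 xy1.
have n0 : 0 <= n%:R :> R by [].
have yn0 : 0 < y + 1 + n%:R by lra.
have := @binet_sub_ge _ (x + 1 + n%:R) (y + 1 + n%:R).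
have -> : y + 1 + n%:R - (x + 1 + n%:R) = y - x by ring.
rewrite -/K => /(_ _ _)/wrap[||]; [lra|lra|].
have : K / (y + 1 + n%:R) < e.
  rewrite ltr_pdivrMr// mulrC -ltr_pdivrMr//; lra.
rewrite /e; lra.
Qed.

Lemma lambdaE {R : realType} (x : R) : 0 < x ->
  lambda x = expR (binet x) / Num.sqrt (2 * pi) - 1.
Proof.
move=> x0; rewrite /lambda; congr (_ - 1).
have p0 : 0 < 2 * pi :> R by rewrite mulr_gt0 ?pi_gt0.
rewrite sqrtrM ?ltW// -[in LHS](lnK (Gamma_gt0 _ x0)).
rewrite -[Num.sqrt x]powR12_sqrt ?ltW// /powR !gt_eqF ?divr_gt0 ?expR_gt0//.
have -> : binet x =
    ln (Gamma (x + 1)) - 2^-1 * ln x - x * ln (x / expR 1).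
  by rewrite ln_div ?posrE ?expR_gt0// expRK /binet; field.
have s0 : 0 < Num.sqrt (2 * pi) :> R by rewrite sqrtr_gt0.
by rewrite 2!expRB; field; rewrite !expR_eq0 gt_eqF.
Qed.

Theorem theorem2p2 (R : realType) :
  forall x y : R, 0 < x -> x < y -> lambda y < lambda x.
Proof.
move=> x y x0 xy; rewrite !lambdaE//; last by lra.
rewrite ltrD2r ltr_pM2r ?ltr_expR ?binet_decr//.
by rewrite invr_gt0 sqrtr_gt0 mulr_gt0 ?pi_gt0.
Qed.
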